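(* Let $T>0$ and $f\in\mathcal{L}_2(T)$. The following four assertions are equivalent: (i) there exists $g\in\mathcal{L}_2(1,1;\mathbb{R})$ whose restriction to $[0,T]$ coincides with $f$ and such that $g'$ has compact support; (ii) there exists $g\in\mathcal{L}_2(1,1;\mathbb{R})$ whose restriction to $[0,T]$ coincides with $f$; (iii) for every $t\in[0,T]$, $|f'(t)|\le\sqrt{2\bigl(1-|f(t)|\bigr)}$; (iv) $|f'(0)|\le\sqrt{2\bigl(1-|f(0)|\bigr)}$ and $|f'(T)|\le\sqrt{2\bigl(1-|f(T)|\bigr)}$.
   Context: For a closed interval $I\subseteq\mathbb{R}$, $\mathcal{L}_2(1,1;I)$ is the set of functions $f:I\to\mathbb{R}$ that are differentiable on $I$ (one-sided at endpoints belonging to $I$), with $f'$ absolutely continuous on every compact subinterval of $I$, such that $|f(t)|\le 1$ for all $t\in I$ and $|f''(t)|\le1$ for almost every $t\in I$ (equivalently, $|f|\le1$ and $f'$ is $1$-Lipschitz). For $T>0$, $\mathcal{L}_2(T)=\mathcal{L}_2(1,1;[0,T])$. *)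

(* Defs.v *)
From HB Require Import structures.
From mathcomp Require Export all_boot all_order all_algebra.
From mathcomp Require Export all_classical all_reals all_analysis.
Export Order.TTheory GRing.Theory Num.Theory.
Export numFieldNormedType.Exports.

Set Implicit Arguments.
Unset Strict Implicit.
Unset Printing Implicit Defensive.

Local Open Scope classical_set_scope.
Local Open Scope ring_scope.

(* A function I -> R is represented by a total function R -> R; everything
   below depends only on its values on I.  The derivative is taken relative to
   I, hence is one-sided at the endpoints that belong to I.  [I] is meant to be
   an interval with more than one point. *)
Definition diff_quot (R : realType) (f : R -> R) (t s : R) : R :=
  (f s - f t) / (s - t).

Definition derivable_within (R : realType) (I : set R) (f : R -> R) (t : R) :=
  cvg (diff_quot f t s @[s --> within I t^']).

Definition derive_within (R : realType) (I : set R) (f : R -> R) (t : R) : R :=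
  lim (diff_quot f t s @[s --> within I t^']).

Definition abs_continuous (R : realType) (a b : R) (f : R -> R) : Prop :=
  forall eps : R, 0 < eps -> exists2 delta : R, 0 < delta &
    forall (n : nat) (u v : 'I_n -> R),
      (forall i, a <= u i /\ u i <= v i /\ v i <= b) ->
      trivIset setT (fun i => `]u i, v i[%classic) ->
      \sum_(i < n) (v i - u i) < delta ->
      \sum_(i < n) `|f (v i) - f (u i)| < eps.

(* The class L_2(1,1;I).  Absolute continuity already gives the existence of the
   second derivative a.e.; it is stated because [lim] has a default value where
   the limit does not exist. *)
Definition L2 (R : realType) (I : set R) (f : R -> R) : Prop :=
  [/\ forall t, I t -> derivable_within I f t,
      forall a b, `[a, b]%classic `<=` I -> abs_continuous a b (derive_within I f),
      forall t, I t -> `|f t| <= 1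
    & {ae lebesgue_measure, forall t : R, I t ->
        derivable_within I (derive_within I f) t /\
        `|derive_within I (derive_within I f) t| <= 1}].

Lemma diff_quot_withinT (R : realType) (f : R -> R) (t : R) :
  diff_quot f t s @[s --> within setT t^'] =
  h^-1 *: (f (h + t) - f t) @[h --> 0^'].
Proof.
have -> : within setT t^' = t^'.
  by rewrite eqEsubset; split => A; rewrite /within/=; apply: filterS => x // /(_ Logic.I).
rewrite eqEsubset; split => A /=.
- move=> /nbhs_ballP[e /= e0 H]; apply/nbhs_ballP; exists e => //= h.
  rewrite /ball/= sub0r normrN => he h0.
  have /H : ball t e (h + t) by rewrite /ball/= opprD addrCA subrr addr0 normrN.
  rewrite /diff_quot addrK mulrC; apply.
  by rewrite -subr_eq0 addrK.
- move=> /nbhs_ballP[e /= e0 H]; apply/nbhs_ballP; exists e => //= s.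
  rewrite /ball/= => ts st.
  have /H : ball (0 : R) e (s - t) by rewrite /ball/= sub0r normrN distrC.
  rewrite subrK /diff_quot mulrC; apply.
  by rewrite subr_eq0.
Qed.

Lemma derive_withinT (R : realType) (f : R -> R) (t : R) :
  derive_within setT f t = f^`()%classic t.
Proof. by rewrite /derive_within diff_quot_withinT. Qed.

Lemma derivable_withinT (R : realType) (f : R -> R) (t : R) :
  derivable_within setT f t <-> derivable f t 1.
Proof.
rewrite /derivable_within diff_quot_withinT /derivable.
suff -> : (fun h : R => h^-1 *: (f (h + t) - f t)) =
  (fun h : R => h^-1 *: ((f \o shift t) (h *: 1) - f t)) by [].
by apply/funext => h /=; rewrite [h *: 1]mulr1.
Qed.

(* Main.v *)
Require Import Defs.
From mathcomp Require Import ring lra.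

(* If f' is absolutely continuous and |f''| <= 1 almost everywhere, then f' is
   1-Lipschitz: cover the exceptional null set by an open set of small measure,
   and chain increments along a Cousin partition whose cells are either
   controlled by the derivative or contained in that open set, where absolute
   continuity makes their total contribution small.

   Landau's inequality for g on the whole line follows from the Taylor
   expansions at t + g'(t) and t - g'(t).  For the extension, brake at unit rate
   from the state (f(T), f'(T)) until rest: the position moves monotonically by
   f'(T)^2/2, which the endpoint condition keeps within [-1, 1]; the same is done
   backwards from 0. *)

Set Implicit Arguments.
Unset Strict Implicit.
Unset Printing Implicit Defensive.

Local Open Scope classical_set_scope.
Local Open Scope ring_scope.

(** * Derivatives as first-order estimates, and continuous induction on an interval *)

(** Clearing the denominator makes the estimate trivial at [s = t], so the puncture disappears;
    errors linear in [s - t] add up along chains of cells. *)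
Lemma cvg_diff_quotP (R : realType) (I : set R) (f : R -> R) (t l : R) :
  diff_quot f t s @[s --> within I t^'] --> l <->
  forall e : R, 0 < e -> exists2 r : R, 0 < r &
    forall s, I s -> `|s - t| < r ->
      `|f s - f t - l * (s - t)| <= e * `|s - t|.
Proof.
split=> [/cvgrPdist_le H e e0|H].
  have := H _ e0; rewrite near_withinE => /nbhs_ballP[r /= r0 K].
  exists r => // s Is st; have [->|neq] := eqVneq s t.
    by rewrite !subrr mulr0 subrr normr0 mulr0.
  have st0 : s - t != 0 by rewrite subr_eq0.
  have := K s; rewrite /ball/= distrC => /(_ st neq Is).
  rewrite /diff_quot distrC -(ler_pM2r (_ : 0 < `|s - t|)) ?normr_gt0//.
  by rewrite -normrM mulrBl divfK.
apply/cvgrPdist_le => e e0; have [r r0 K] := H _ e0.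
rewrite near_withinE; apply/nbhs_ballP; exists r => //= s.
rewrite /ball/= distrC => st neq Is.
have st0 : s - t != 0 by rewrite subr_eq0.
rewrite /diff_quot distrC -(@ler_pM2r _ `|s - t|) ?normr_gt0//.
by rewrite -normrM mulrBl divfK//; exact: K.
Qed.

(** Continuous induction: at the supremum [c] of the points [x] with [Q a x], the local property
    reaches beyond [c] unless [c = b]. It concerns only cells containing [c], as these are the ones
    a derivative at [c] controls. *)
Lemma cousin (R : realType) (a b : R) (Q : R -> R -> Prop) :
  a <= b ->
  (forall x y z, a <= x -> x <= y -> y <= z -> z <= b ->
    Q x y -> Q y z -> Q x z) ->
  (forall c, a <= c <= b -> exists2 r : R, 0 < r &
    forall x y, a <= x -> x <= c -> c <= y -> y <= b ->
      `|x - c| < r -> `|y - c| < r -> Q x y) ->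
  Q a b.
Proof.
move=> ab Qtrans Qloc.
pose S : set R := [set x | a <= x <= b /\ Q a x].
have Sa : S a.
  split; first by rewrite lexx.
  have [|r r0] := Qloc a; first by rewrite lexx.
  by apply => //; rewrite subrr normr0.
have Sub : ubound S b by move=> x [/andP[_ ?] _].
have Ssup : has_sup S by split; [exists a|exists b].
have ac : a <= sup S by exact: (ub_le_sup (proj2 Ssup)).
have cb : sup S <= b by apply: ge_sup; first exists a.
set c := sup S in ac cb.
have [|r r0 loc] := Qloc c; first by rewrite ac.
have [x [/andP[ax xb] Qax] cx] := sup_adherent r0 Ssup.
have xc : x <= c by apply: (ub_le_sup (proj2 Ssup)); split => //; rewrite ax.
(* This [y] lies within [r] of [c], and exceeds [c] unless [b] is reached; [y <= c] will therefore
   force [y = b]. *)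
pose y := Num.min b (c + r / 2).
have cy : c <= y by rewrite le_min cb lerDl; lra.
have yb : y <= b by rewrite ge_min lexx.
have yr : y <= c + r / 2 by rewrite ge_min lexx orbT.
have Sy : S y.
  split; first by rewrite yb andbT; lra.
  have ay : x <= y by lra.
  apply: (Qtrans a x y) => //.
  apply: loc => //.
  - by rewrite ler0_norm -/c in cx *; lra.
  - by rewrite ger0_norm; lra.
have yc : y <= c by exact: (ub_le_sup (proj2 Ssup)).
have -> : b = y.
  by move: yc; rewrite /y; case: (leP b (c + r / 2)) => //; lra.
by case: Sy.
Qed.

(** * Increment bounds from pointwise and from almost everywhere derivative bounds *)

(** Mean value inequality with a variable majorant: on a small cell around [c] both increments are
    linear up to [e'] times the length, and such bounds chain. *)
Lemma increment_le (R : realType) (a b : R) (f df p dp : R -> R) :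
  a <= b ->
  (forall t, a <= t <= b ->
    diff_quot f t s @[s --> within `[a, b] t^'] --> df t) ->
  (forall t, a <= t <= b ->
    diff_quot p t s @[s --> within `[a, b] t^'] --> dp t) ->
  (forall t, a <= t <= b -> `|df t| <= dp t) ->
  `|f b - f a| <= p b - p a.
Proof.
move=> ab cf cp fp; apply/ler_addgt0Pr => e e0.
have d0 : 0 < b - a + 1 by lra.
(* The factor 2 pays for the errors of both [f] and [p]; the [+ 1] keeps the denominator positive
   when [a = b]. *)
have [e' e'0 ee'] : exists2 e', 0 < e' & 2 * e' * (b - a) <= e.
  exists (e / 2 / (b - a + 1)); first by rewrite !divr_gt0.
  have -> : 2 * (e / 2 / (b - a + 1)) * (b - a) = e * ((b - a) / (b - a + 1)).
    by field; rewrite gt_eqF.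
  by rewrite ler_piMr ?(ltW e0)// ler_pdivrMr//; lra.
suff : `|f b - f a| <= p b - p a + 2 * e' * (b - a) by lra.
apply: (@cousin _ a b (fun x y => `|f y - f x| <= p y - p x + 2 * e' * (y - x)))
  => // [x y z _ _ _ _|c cab]; first by rewrite !ler_norml; lra.
have /cvg_diff_quotP/(_ _ e'0)[r r0 fr] := cf _ cab.
have /cvg_diff_quotP/(_ _ e'0)[q q0 pq] := cp _ cab.
exists (Num.min r q); first by rewrite lt_min r0.
move=> x y ax xc cy yb; rewrite !lt_min => /andP[xr xq] /andP[yr yq].
have xI : `[a, b]%classic x by rewrite /= in_itv/=; apply/andP; split; lra.
have yI : `[a, b]%classic y by rewrite /= in_itv/=; apply/andP; split; lra.
have := fr x xI xr; have := fr y yI yr; have := pq x xI xq; have := pq y yI yq.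
rewrite (ler0_norm (_ : x - c <= 0)) ?(ger0_norm (_ : 0 <= y - c)); [|lra..].
have := fp _ cab; rewrite !ler_norml.
move=> /andP[H1 H2].
have : df c * (y - x) <= dp c * (y - x) by rewrite ler_wpM2r//; lra.
have : - dp c * (y - x) <= df c * (y - x) by rewrite ler_wpM2r//; lra.
lra.
Qed.

(** Links the finite sums of [abs_continuous] to the measure of a cover: additivity over disjoint
    intervals, then monotonicity. *)
Lemma sum_itv_length_le (R : realType) n (u v : 'I_n -> R) (U : set R) :
  measurable U -> (forall i, u i <= v i) ->
  trivIset setT (fun i => `]u i, v i[%classic) ->
  (forall i, `]u i, v i[%classic `<=` U) ->
  ((\sum_(i < n) (v i - u i))%:E <= lebesgue_measure U)%E.
Proof.
move=> mU uv triv sub.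
rewrite -sumEFin (eq_bigr (fun i => lebesgue_measure `]u i, v i[%classic)); last first.
  move=> i _; rewrite lebesgue_measure_itv/= lte_fin.
  by move: (uv i); rewrite le_eqVlt => /predU1P[->|->]//; rewrite ltxx subrr.
rewrite -measure_bigsetU_ord//.
apply: le_measure; rewrite ?inE.
- by apply: bigsetU_measurable => i _; exact: measurable_itv.
- exact: mU.
- by elim/big_ind: _ => // X Y; rewrite subUset.
Qed.

Lemma ac_increment_le (R : realType) (a b K : R) (F : R -> R) :
  a <= b -> 0 <= K -> abs_continuous a b F ->
  {ae lebesgue_measure, forall t : R, a <= t <= b ->
    forall e : R, 0 < e -> exists2 r : R, 0 < r & forall s, a <= s <= b ->
      `|s - t| < r -> `|F s - F t| <= (K + e) * `|s - t|} ->
  `|F b - F a| <= K * (b - a).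
Proof.
move=> ab K0 acF [A [mA A0 NA]]; apply/ler_addgt0Pr => e' e'0.
have d0 : 0 < b - a + 1 by lra.
(* The budget [e * (b - a + 1)] splits into [e * (b - a)] for the excess slope on good cells and [e]
   for all cells inside [U]. *)
have [e e0 ee'] : exists2 e, 0 < e & e * (b - a + 1) <= e'.
  by exists (e' / (b - a + 1)); [rewrite divr_gt0|rewrite divfK// gt_eqF].
have [delta delta0 small] := acF _ e0.
have [|U [oU AU Ud]] := @lebesgue_regularity_outer _ A delta mA _ delta0.
  by rewrite [X in (X < _)%E]A0.
(* Regularity bounds only the measure of [U] minus [A]; as [A] is null, the bound passes to [U]. *)
have {}Ud : (lebesgue_measure U < delta%:E)%E.
  have mU : measurable U by exact: measurable_realfun.open_measurable.
  rewrite -(setDUK AU) measureU//.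
  - by rewrite [X in (X + _)%E](_ : _ = 0%E) ?add0e.
  - exact: measurableD.
  - by rewrite setDE setICA setICr setI0.
(* The list [P] collects the cells lying in [U]. Keeping it ordered from left to right makes
   concatenation easy and yields disjointness at the end. *)
pose tot (P : seq (R * R)) := \sum_(p <- P) `|F p.2 - F p.1|.
pose good x y (P : seq (R * R)) := [/\
  all (fun p => (x <= p.1) && (p.1 <= p.2) && (p.2 <= y)) P,
  pairwise (fun p q => p.2 <= q.1) P &
  forall p, p \in P -> `]p.1, p.2[%classic `<=` U].
have : exists2 P, good a b P & `|F b - F a| <= (K + e) * (b - a) + tot P.
  apply: (@cousin _ a b
    (fun x y => exists2 P, good x y P & `|F y - F x| <= (K + e) * (y - x) + tot P))
    => // [x y z ax xy yz zb [P [P1 P2 P3] P4] [P' [P'1 P'2 P'3] P'4]|c cab].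
    exists (P ++ P'); first split.
    - rewrite all_cat; apply/andP; split.
        apply/allP => p /(allP P1) /andP[/andP[-> ->]]/=.
        by move=> /le_trans; apply.
      apply/allP => p /(allP P'1) /andP[/andP[h -> ->]]; rewrite !andbT.
      exact: le_trans h.
    - rewrite pairwise_cat P2 P'2 !andbT; apply/allrelP => p q.
      move=> /(allP P1) /andP[_ h] /(allP P'1) /andP[/andP[h' _] _].
      exact: le_trans h'.
    - by move=> p; rewrite mem_cat => /orP[/P3|/P'3].
    - by rewrite /tot big_cat/= -/(tot P) -/(tot P'); move: P4 P'4; rewrite !ler_norml; lra.
  (* Around an exceptional point the whole cell is put in the list; around any other point the slope
     bound suffices and the list is empty. *)
  have [Ac|nAc] := pselect (A c).
    have /open_nbhs_nbhs : open_nbhs c U by split => //; exact: AU.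
    move=> /nbhs_ballP[r /= r0 rU]; exists r => // x y ax xc cy yb xr yr.
    have xy : x <= y by lra.
    exists [:: (x, y)]; first split => //=.
    - by rewrite !lexx xy.
    - move=> p; rewrite inE => /eqP -> /= z; rewrite /= in_itv/= => /andP[xz zy].
      apply: rU; rewrite /ball/= distrC; move: xr yr.
      rewrite ltr_norml !ltr_norml; lra.
    - rewrite /tot big_seq1/= lerDr.
      by rewrite mulr_ge0//; lra.
  have := contra_not (@NA c) nAc; rewrite /= notK => /(_ cab _ e0)[r r0 H].
  exists r => // x y ax xc cy yb xr yr.
  exists [::]; first by split.
  rewrite /tot big_nil addr0.
  have := H x; have := H y; rewrite xr yr.
  rewrite (ler0_norm (_ : x - c <= 0)) ?(ger0_norm (_ : 0 <= y - c)); [|lra..].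
  have -> : (a <= x <= b) by apply/andP; split; lra.
  have -> : (a <= y <= b) by apply/andP; split; lra.
  move=> /(_ isT isT) + /(_ isT isT); rewrite !ler_norml; lra.
move=> [P [P1 P2 P3] P4].
suff : tot P < e by lra.
pose z : R * R := (0, 0).
rewrite /tot (big_nth z) big_mkord.
have triv : trivIset setT
    (fun i : 'I_(size P) => `](nth z P i).1, (nth z P i).2[%classic).
  apply/trivIsetP => i j _ _; wlog ij : i j / (i < j)%N.
    move=> W; have := neq_ltn i j; rewrite /= => + ij; rewrite ij => /esym/orP[|] ?.
      exact: W.
    by rewrite setIC; apply: W; rewrite // eq_sym.
  move=> _; rewrite -subset0 => x [] /=; rewrite !in_itv/= => /andP[_ h] /andP[h' _].
  have /(pairwiseP z)/(_ i j (ltn_ord i) (ltn_ord j) ij) := P2.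
  lra.
apply: small.
- move=> i; have /(allP P1) := mem_nth z (ltn_ord i).
  by move=> /andP[/andP[]].
- exact: triv.
rewrite -lte_fin; apply: le_lt_trans Ud; apply: sum_itv_length_le => // [|i|i].
- exact: measurable_realfun.open_measurable.
- by have /(allP P1) /andP[/andP[]] := mem_nth z (ltn_ord i).
- by apply: P3; exact: mem_nth.
Qed.

(** * Uniqueness and locality of the derivative within a set *)

(** The accumulation hypothesis makes the punctured filter proper, so that the limit is unique. *)
Lemma derive_within_lim (R : realType) (I : set R) (f : R -> R) (t l : R) :
  (forall r : R, 0 < r -> exists2 s, I s & 0 < `|s - t| < r) ->
  diff_quot f t s @[s --> within I t^'] --> l -> derive_within I f t = l.
Proof.
move=> accI fl; have PF : ProperFilter (within I t^').
  apply: Build_ProperFilter_ex => A; rewrite /within/= => /nbhs_ballP[r /= r0 rA].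
  have [s Is /andP[ts st]] := accI _ r0.
  exists s; apply: rA => //; first by rewrite /ball/= distrC.
  by rewrite -subr_eq0 -normr_gt0.
exact: cvg_lim.
Qed.

Lemma derivable_within_near (R : realType) (I : set R) (f h : R -> R) (t : R) :
  nbhs t I -> {near t, f =1 h} -> derivable_within I f t ->
  derivable_within setT h t.
Proof.
move=> /nbhs_ballP[r1 /= r10 rI] /nbhs_ballP[r2 /= r20 rE] /cvg_diff_quotP fl.
have fht : f t = h t by apply: rE; exact: ballxx.
apply/cvg_ex; exists (derive_within I f t); apply/cvg_diff_quotP => e e0.
have [r r0 H] := fl _ e0.
exists (Num.min r (Num.min r1 r2)); first by rewrite !lt_min r0 r10 r20.
move=> s _; rewrite !lt_min => /and3P[sr sr1 sr2].
have <- : f s = h s by apply: rE; rewrite /ball/= distrC.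
by rewrite -fht; apply: H => //; apply: rI; rewrite /ball/= distrC.
Qed.

Lemma near_affine_derivable_within (R : realType) (h : R -> R) (t l : R) :
  (\forall s \near t, h s = h t + l * (s - t)) -> derivable_within setT h t.
Proof.
move=> /nbhs_ballP[r /= r0 H]; apply/cvg_ex; exists l.
apply/cvg_diff_quotP => e e0; exists r => // s _ st.
rewrite H; last by rewrite /ball/= distrC.
have -> : h t + l * (s - t) - h t - l * (s - t) = 0 by ring.
by rewrite normr0 mulr_ge0// ltW.
Qed.

(** * Jets: gluing and the quadratic model *)

(* [d] is 1-Lipschitz on [I] and is the derivative of [g] there, in the
   integrated form that survives gluing along a common endpoint. *)
Definition jet (R : realType) (I : set R) (g d : R -> R) : Prop :=
  forall s t, I s -> I t -> `|d s - d t| <= `|s - t| /\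
    `|g s - g t - d t * (s - t)| <= (s - t) ^+ 2 / 2.

Lemma jet_cvg (R : realType) (I : set R) (g d : R -> R) (t : R) :
  jet I g d -> I t -> diff_quot g t s @[s --> within I t^'] --> d t.
Proof.
move=> gd It; apply/cvg_diff_quotP => e e0; exists e => // s Is st.
have [_ /le_trans->//] := gd s t Is It.
rewrite -real_normK ?num_real// expr2 -mulrA mulrC ler_wpM2r//.
by have := normr_ge0 (s - t); lra.
Qed.

Lemma eq_jet (R : realType) (I : set R) (g d g' d' : R -> R) :
  (forall t, I t -> g t = g' t) -> (forall t, I t -> d t = d' t) ->
  jet I g d -> jet I g' d'.
Proof.
by move=> gg dd gd s t Is It; rewrite -!gg// -!dd//; exact: gd.
Qed.

Lemma sub_jet (R : realType) (I J : set R) (g d : R -> R) :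
  J `<=` I -> jet I g d -> jet J g d.
Proof. by move=> JI gd s t /JI Is /JI It; exact: gd. Qed.

(** For [s] and [t] on opposite sides of [b], the remainders through [b] add up with the cross term
    [(d b - d t) * (s - b)]. Since [p^2/2 + q^2/2 + p*q = (p + q)^2/2], the constant 1/2
    survives. *)
Lemma jet_glue (R : realType) (I : set R) (b : R) (g d : R -> R) : I b ->
  jet (I `&` [set t | t <= b]) g d -> jet (I `&` [set t | b <= t]) g d ->
  jet I g d.
Proof.
move=> Ib jl jr s t Is It.
have [sb|/ltW bs] := leP s b; have [tb|/ltW bt] := leP t b.
- by apply: jl.
- move: (jl s b (conj Is sb) (conj Ib (lexx b))) (jr b t (conj Ib (lexx b)) (conj It bt)) => [+ +] [].
  rewrite (ler0_norm (_ : s - t <= 0)); last by lra.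
  rewrite (ler0_norm (_ : s - b <= 0)) ?(ler0_norm (_ : b - t <= 0)); [|lra..].
  rewrite !ler_norml => /andP[H1 H2] /andP[H3 H4] /andP[H5 H6] /andP[H7 H8].
  have : (d b - d t) * (b - s) <= (t - b) * (b - s) by rewrite ler_wpM2r//; lra.
  have : - (t - b) * (b - s) <= (d b - d t) * (b - s) by rewrite ler_wpM2r//; lra.
  by split; [lra | nra].
- move: (jl b t (conj Ib (lexx b)) (conj It tb)) (jr s b (conj Is bs) (conj Ib (lexx b))) => [+ +] [].
  rewrite (ger0_norm (_ : 0 <= s - t)); last by lra.
  rewrite (ger0_norm (_ : 0 <= s - b)) ?(ger0_norm (_ : 0 <= b - t)); [|lra..].
  rewrite !ler_norml => /andP[H1 H2] /andP[H3 H4] /andP[H5 H6] /andP[H7 H8].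
  have : (d b - d t) * (s - b) <= (b - t) * (s - b) by rewrite ler_wpM2r//; lra.
  have : - (b - t) * (s - b) <= (d b - d t) * (s - b) by rewrite ler_wpM2r//; lra.
  by split; [lra | nra].
- by apply: jr.
Qed.

(** The remainder is exactly [c * (s - u)^2 / 2]. With [c] equal to 1 or -1 this parabola serves as
    majorant to the right or left of [t]. *)
Lemma jet_quadratic (R : realType) (t c : R) : `|c| <= 1 ->
  jet setT (fun x => c * (x - t) ^+ 2 / 2) (fun x => c * (x - t)).
Proof.
move=> c1 s u _ _; split.
  have -> : c * (s - t) - c * (u - t) = c * (s - u) by ring.
  by rewrite normrM ler_piMl.
have -> : c * (s - t) ^+ 2 / 2 - c * (u - t) ^+ 2 / 2 - c * (u - t) * (s - u) =
  c * ((s - u) ^+ 2 / 2) by field.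
by rewrite normrM (ger0_norm (_ : 0 <= (s - u) ^+ 2 / 2)) ?ler_piMl// divr_ge0// sqr_ge0.
Qed.

(** * Passage between the class [L2] and jets *)

(** The almost everywhere bound on the second derivative makes [d] 1-Lipschitz; then [f u - d t * u]
    has derivative [d u - d t], of size at most [|u - t|], and the mean value inequality integrates
    this. *)
Lemma L2_jet (R : realType) (I : set R) (f : R -> R) (a b : R) :
  L2 I f -> `[a, b]%classic `<=` I -> jet `[a, b]%classic f (derive_within I f).
Proof.
move=> [df acdf _ ddf] abI.
set d := derive_within I f.
have d_lip x y : a <= x -> x <= y -> y <= b -> `|d y - d x| <= y - x.
  move=> ax xy yb; rewrite -[leRHS]mul1r; apply: ac_increment_le => //.
    by apply: acdf => z; rewrite /= in_itv/= => /andP[xz zy]; apply: abI;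
      rewrite /= in_itv/=; apply/andP; split; lra.
  move: ddf; apply: negligibleS => t; apply: contra_not => H /andP[xt ty] e e0.
  have sub s : x <= s <= y -> I s.
    by move=> /andP[xs sy]; apply: abI; rewrite /= in_itv/=; apply/andP; split; lra.
  have [|/cvg_diff_quotP dt t1] := H; first by apply: sub; rewrite xt.
  have [r r0 {}H] := dt _ e0.
  exists r => // s xsy st; have := H s (sub _ xsy) st.
  rewrite -/d; set l := derive_within I d t in t1 *.
  have : `|l * (s - t)| <= `|s - t| by rewrite normrM ler_piMl.
  have := ler_normD (d s - d t - l * (s - t)) (l * (s - t)).
  rewrite subrK; lra.
move=> s t; rewrite /= !in_itv/= => /andP[as_ sb] /andP[at_ tb].
(* Here [c] is the sign of [u - t] on [[x, y]], so [c * (u - t)] is [|u - t|]; [t] will be an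
   endpoint of that interval. *)
have key x y (c : R) : a <= x -> x <= y -> y <= b -> `|c| = 1 ->
    (forall u, x <= u <= y -> `|u - t| = c * (u - t)) ->
    x <= t <= y ->
    `|(f y - d t * y) - (f x - d t * x)| <= c * (y - t) ^+ 2 / 2 - c * (x - t) ^+ 2 / 2.
  move=> ax xy yb c1 cE xty.
  apply: (@increment_le _ x y (fun u => f u - d t * u) (fun u => d u - d t)
    (fun u => c * (u - t) ^+ 2 / 2) (fun u => c * (u - t))) => // u xuy.
  - have /df/cvg_diff_quotP H : I u.
      by apply: abI; rewrite /= in_itv/=; apply/andP; move: xuy => /andP[? ?]; split; lra.
    apply/cvg_diff_quotP => e e0; have [r r0 {}H] := H _ e0; exists r => // z.
    rewrite /= in_itv/= => /andP[xz zy] zu.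
    have Iz : I z by apply: abI; rewrite /= in_itv/=; apply/andP; split; lra.
    have := H z Iz zu; rewrite -/(d u).
    by have -> : f z - d t * z - (f u - d t * u) - (d u - d t) * (z - u) =
      f z - f u - d u * (z - u) by ring.
  - have := @jet_quadratic _ t c; rewrite c1 lexx => /(_ isT) J.
    have /cvg_diff_quotP J' := @jet_cvg _ _ _ _ u J Logic.I.
    apply/cvg_diff_quotP => e e0; have [r r0 {}J'] := J' _ e0.
    by exists r => // z _; exact: J'.
  - rewrite -cE//; move: xuy xty => /andP[xu uy] /andP[xt ty].
    have [ut|/ltW tu] := leP u t.
      rewrite distrC (ler0_norm (_ : u - t <= 0)) ?opprB; last by lra.
      by apply: d_lip; lra.
    by rewrite (ger0_norm (_ : 0 <= u - t)); [apply: d_lip|]; lra.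
have [st|/ltW ts] := leP s t.
  split.
    by rewrite distrC (ler0_norm (_ : s - t <= 0)) ?opprB; [apply: d_lip|]; lra.
  have := key s t (-1) as_ st tb; rewrite normrN1 => /(_ erefl).
  have h u : s <= u <= t -> `|u - t| = -1 * (u - t).
    by move=> /andP[_ ut]; rewrite ler0_norm; lra.
  move=> /(_ h); rewrite st lexx => /(_ isT); rewrite distrC.
  have -> : f s - d t * s - (f t - d t * t) = f s - f t - d t * (s - t) by ring.
  lra.
split.
  by rewrite (ger0_norm (_ : 0 <= s - t)); [apply: d_lip|]; lra.
have := key t s 1 at_ ts sb; rewrite normr1 => /(_ erefl).
have h u : t <= u <= s -> `|u - t| = 1 * (u - t).
  by move=> /andP[ut _]; rewrite ger0_norm; lra.
move=> /(_ h); rewrite ts lexx => /(_ isT).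
have -> : f s - d t * s - (f t - d t * t) = f s - f t - d t * (s - t) by ring.
lra.
Qed.

(** The Lipschitz bound gives absolute continuity with [delta = eps], and bounds the derivative of
    [d] by 1 wherever it exists. *)
Lemma L2_of_jet (R : realType) (g d : R -> R) :
  jet setT g d -> (forall t, `|g t| <= 1) ->
  {ae lebesgue_measure, forall t : R, derivable_within setT d t} ->
  L2 setT g /\ derive_within setT g = d.
Proof.
move=> gd g1 dd.
have accT (t r : R) : 0 < r -> exists2 s, [set: R] s & 0 < `|s - t| < r.
  move=> r0; exists (t + r / 2) => //.
  by rewrite addrAC subrr add0r ger0_norm; lra.
have dE : derive_within setT g = d.
  by apply/funext => t; apply: derive_within_lim; [exact: accT|exact: (jet_cvg gd)].
split=> //; split => //.
- by move=> t _; apply/cvg_ex; exists (d t); exact: jet_cvg gd _.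
- move=> a b _; rewrite dE => e e0; exists e => // n u v uv _; apply: le_lt_trans.
  apply: ler_sum => i _; have [] := gd (v i) (u i) Logic.I Logic.I.
  by move: (uv i) => [_ [uvi _]]; rewrite (ger0_norm (_ : 0 <= v i - u i)); lra.
- move: dd; apply: negligibleS => t; apply: contra_not => + _; rewrite dE => dt.
  split=> //; apply/ler_addgt0Pr => e e0.
  have /cvg_diff_quotP/(_ _ e0)[r r0 H] := dt.
  (* A single [s] close to [t] suffices: dividing by [|s - t|] gives the bound [1 + e]. *)
  have [s _ /andP[s0 sr]] := accT t r r0.
  rewrite -(ler_pM2r s0) -normrM mulrDl mul1r.
  have := H s Logic.I sr; have [+ _] := gd s t Logic.I Logic.I.
  have := ler_normB (d s - d t) (d s - d t - derive_within setT d t * (s - t)).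
  by rewrite opprB addrC subrK; lra.
Qed.

Lemma jet_setT (R : realType) (g d : R -> R) :
  (forall a b, jet `[a, b]%classic g d) -> jet setT g d.
Proof.
by move=> gd s t _ _; apply: (gd (Num.min s t) (Num.max s t));
  rewrite /= in_itv/= ge_min le_max lexx ?orbT.
Qed.

(** * Landau's inequality on the line *)

Lemma jet_landau (R : realType) (g d : R -> R) (t : R) :
  jet setT g d -> (forall t, `|g t| <= 1) ->
  `|d t| <= Num.sqrt (2 * (1 - `|g t|)).
Proof.
move=> gd g1; rewrite -sqrtr_sqr ler_wsqrtr//.
(* The steps [d t] and [- d t] give [g t + (d t)^2/2 <= 1] and [g t - (d t)^2/2 >= -1]; the sign of
   [g t] decides which one is used. *)
have [_] := gd (t + d t) t Logic.I Logic.I; have := g1 (t + d t).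
have [_] := gd (t - d t) t Logic.I Logic.I; have := g1 (t - d t).
rewrite !ler_norml addrAC subrr add0r [t + _ - t]addrAC subrr add0r.
rewrite sqrrN => /andP[? ?] /andP[? ?] /andP[? ?] /andP[? ?].
have [|] := leP 0 (g t) => ?.
  by rewrite ger0_norm//; lra.
by rewrite ltr0_norm//; lra.
Qed.

(** * Braking at unit rate *)

(* Position and velocity at time [s] when starting from [y] with velocity [v]
   and braking at unit rate until rest; for [s < 0] this is the parabola. *)
Definition brake_pos (R : realType) (y v s : R) : R :=
  let m := Num.min s `|v| in y + v * m - Num.sg v * m ^+ 2 / 2.

Definition brake_vel (R : realType) (v s : R) : R :=
  v - Num.sg v * Num.min s `|v|.

Lemma brake_jet (R : realType) (y v : R) :
  jet setT (brake_pos y v) (brake_vel v).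
Proof.
move=> s t _ _; rewrite /brake_pos /brake_vel.
have w0 : 0 <= `|v| by [].
have sg1 : `|Num.sg v| <= 1 by rewrite normr_sg; case: (v != 0).
(* With [v = c * w], every difference below is [c] times an expression in [w], [s], [t]; only
   [|c| <= 1] matters, which includes [v = 0]. *)
move: (Num.sg v) (`|v|) w0 sg1 (numEsg v) => c w w0 c1 ->.
have cM (x z : R) : `|x| <= z -> `|c * x| <= z.
  by move=> /(le_trans _); apply; rewrite normrM ler_piMl.
have [sw|/ltW ws] := leP s w; have [tw|/ltW wt] := leP t w.
- rewrite (_ : c * w - c * s - (c * w - c * t) = c * (t - s)); last by ring.
  rewrite (_ : y + _ - _ - _ - _ = c * (- (s - t) ^+ 2 / 2)); last by field.
  split; apply: cM; first by rewrite distrC.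
  by rewrite mulNr normrN ger0_norm ?divr_ge0 ?sqr_ge0.
- rewrite (_ : c * w - c * s - (c * w - c * w) = c * (w - s)); last by ring.
  rewrite (_ : y + _ - _ - _ - _ = c * (- (s - w) ^+ 2 / 2)); last by field.
  split; apply: cM.
    by rewrite ger0_norm ?(ler0_norm (_ : s - t <= 0)); lra.
  by rewrite mulNr normrN ger0_norm ?divr_ge0 ?sqr_ge0//; nra.
- rewrite (_ : c * w - c * w - (c * w - c * t) = c * (t - w)); last by ring.
  rewrite (_ : y + _ - _ - _ - _ = c * ((w - t) ^+ 2 / 2 - (w - t) * (s - t))); last by field.
  split; apply: cM.
    by rewrite ler0_norm ?(ger0_norm (_ : 0 <= s - t)); lra.
  by rewrite ler_norml; apply/andP; split; nra.
- rewrite (_ : c * w - c * w - (c * w - c * w) = 0); last by ring.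
  rewrite (_ : y + _ - _ - _ - _ = 0); last by field.
  by rewrite normr0 divr_ge0 ?sqr_ge0.
Qed.

(** The only possible kink is the rest time [|v|], and the radius is the distance to it; at
    [t = |v|] the claim is vacuous. *)
Lemma brake_vel_affine (R : realType) (v t : R) : exists l, forall s,
  `|s - t| < `|t - `|v| | -> brake_vel v s = brake_vel v t + l * (s - t).
Proof.
have [tv|vt] := leP t `|v|.
  exists (- Num.sg v) => s; rewrite (ler0_norm (_ : t - _ <= 0)); last by lra.
  rewrite ltr_norml => /andP[_ sv].
  by rewrite /brake_vel !min_l; [ring|lra..].
exists 0 => s; rewrite (gtr0_norm (_ : 0 < t - _)); last by lra.
rewrite ltr_norml => /andP[sv _].
by rewrite /brake_vel !min_r; [ring|lra..].
Qed.

Lemma brake_vel_eq0 (R : realType) (v s : R) : `|v| <= s -> brake_vel v s = 0.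
Proof. by move=> vs; rewrite /brake_vel min_r// -numEsg subrr. Qed.

Lemma brake_vel0 (R : realType) (v : R) : brake_vel v 0 = v.
Proof. by rewrite /brake_vel min_l// mulr0 subr0. Qed.

Lemma brake_pos0 (R : realType) (y v : R) : brake_pos y v 0 = y.
Proof. by rewrite /brake_pos min_l// expr0n/=; ring. Qed.

(** With [w = |v|], the distance travelled is at most [w * m - m^2/2], which is at most [w^2/2]
    because [(w - m)^2 >= 0], hence at most [1 - |y|]. *)
Lemma brake_pos_le1 (R : realType) (y v s : R) : `|y| <= 1 ->
  `|v| <= Num.sqrt (2 * (1 - `|y|)) -> 0 <= s -> `|brake_pos y v s| <= 1.
Proof.
move=> y1 vy s0.
have {vy} : `|v| ^+ 2 <= 2 * (1 - `|y|).
  have h : 0 <= 2 * (1 - `|y|) by lra.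
  by rewrite -[leRHS]sqr_sqrtr// ler_sqr ?nnegrE.
have sg1 : `|Num.sg v| <= 1 by rewrite normr_sg; case: (v != 0).
have w0 : 0 <= `|v| by [].
rewrite /brake_pos; set m := Num.min s _.
have m0 : 0 <= m by rewrite le_min s0.
have mv : m <= `|v| by rewrite ge_min lexx orbT.
move: (Num.sg v) (`|v|) w0 sg1 (numEsg v) m0 mv => c w w0 c1 -> m0 mv wy.
rewrite (_ : y + _ - _ = y + c * (w * m - m ^+ 2 / 2)); last by field.
have X0 : 0 <= w * m - m ^+ 2 / 2 by nra.
apply: le_trans (ler_normD _ _) _; rewrite normrM (ger0_norm X0).
have : `|c| * (w * m - m ^+ 2 / 2) <= w * m - m ^+ 2 / 2 by rewrite ler_piMl.
by have := sqr_ge0 (w - m); lra.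
Qed.

(** * The extension to the line *)

Lemma jet_reflect (R : realType) (g d : R -> R) (c : R) : jet setT g d ->
  jet setT (fun t => g (c - t)) (fun t => - d (c - t)).
Proof.
move=> gd s t _ _; have [] := gd (c - s) (c - t) Logic.I Logic.I.
have -> : c - s - (c - t) = t - s by ring.
have -> : - d (c - s) - - d (c - t) = - (d (c - s) - d (c - t)) by ring.
have -> : - d (c - t) * (s - t) = d (c - t) * (t - s) by ring.
by rewrite normrN (distrC t) -sqrrN opprB.
Qed.

Lemma jet_shift (R : realType) (g d : R -> R) (c : R) : jet setT g d ->
  jet setT (fun t => g (t - c)) (fun t => d (t - c)).
Proof.
move=> gd s t _ _; have [] := gd (s - c) (t - c) Logic.I Logic.I.
by have -> : s - c - (t - c) = s - t by ring.
Qed.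

(** Left of 0 time runs backwards, so braking starts with velocity [- d 0]; the form [0 - t] matches
    [jet_reflect] at [c = 0]. *)
Definition extend (R : realType) (T : R) (f d : R -> R) (t : R) : R :=
  if t < 0 then brake_pos (f 0) (- d 0) (0 - t)
  else if t <= T then f t else brake_pos (f T) (d T) (t - T).

Definition extend_vel (R : realType) (T : R) (d : R -> R) (t : R) : R :=
  if t < 0 then - brake_vel (- d 0) (0 - t)
  else if t <= T then d t else brake_vel (d T) (t - T).

(** Two gluings, at 0 and at [T]. Both junctions belong to the branch of [f], so the braking
    branches must be shown to agree there in position and velocity. *)
Lemma extend_jet (R : realType) (T : R) (f d : R -> R) : 0 < T ->
  jet `[0, T]%classic f d -> jet setT (extend T f d) (extend_vel T d).
Proof.
move=> T0 fd; apply: (@jet_glue _ _ 0) => //.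
  apply: eq_jet (sub_jet (@subsetT _ _) (jet_reflect 0 (brake_jet (f 0) (- d 0)))).
    move=> t [_ /= t0]; rewrite /extend; case: ltP => // ?.
    have -> : t = 0 by lra.
    by rewrite ltW// subrr brake_pos0.
  move=> t [_ /= t0]; rewrite /extend_vel; case: ltP => // ?.
  have -> : t = 0 by lra.
  by rewrite ltW// subrr brake_vel0 opprK.
apply: (@jet_glue _ _ T); first by split => //=; exact: ltW.
  have sub : [set: R] `&` [set t | 0 <= t] `&` [set t | t <= T] `<=` `[0, T]%classic.
    by move=> t [[_ /= t0] tT]; rewrite /= in_itv/= t0.
  by apply: eq_jet (sub_jet sub fd) => t [[_ /= t0] /= tT];
    rewrite /extend /extend_vel ltNge t0/= tT.
apply: eq_jet (sub_jet (@subsetT _ _) (jet_shift T (brake_jet (f T) (d T)))).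
  move=> t [[_ /= t0] /= tT]; rewrite /extend ltNge t0/=; case: leP => // ?.
  have -> : t = T by lra.
  by rewrite subrr brake_pos0.
move=> t [[_ /= t0] /= tT]; rewrite /extend_vel ltNge t0/=; case: leP => // ?.
have -> : t = T by lra.
by rewrite subrr brake_vel0.
Qed.

(** The excluded points are the two junctions and the two instants of rest; elsewhere the velocity
    is locally affine or locally equal to [d]. *)
Lemma extend_vel_derivable (R : realType) (T : R) (d : R -> R) (t : R) : 0 < T ->
  t \notin [:: 0; T; - `|d 0|; T + `|d T|] ->
  (0 <= t <= T -> derivable_within `[0, T] d t) ->
  derivable_within setT (extend_vel T d) t.
Proof.
move=> T0; rewrite !inE !negb_or => /and4P[t0 tT td0 tdT] dd.
have [lt_t0|gt_t0] := ltP t 0.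
  have [l H] := brake_vel_affine (- d 0) (0 - t).
  have r0 : 0 < `|0 - t - `|- d 0| |.
    by rewrite normr_gt0 normrN; apply: contra td0 => /eqP ?; apply/eqP; lra.
  apply: (@near_affine_derivable_within _ _ _ l); near=> s.
  have s0 : s < 0 by near: s; exact: lt_nbhsl.
  rewrite /extend_vel s0 lt_t0 (H (0 - s)); first by ring.
  have -> : 0 - s - (0 - t) = t - s by ring.
  by near: s; exact: (nbhsx_ballx t _ r0).
have {}gt_t0 : 0 < t by rewrite lt_neqAle eq_sym t0.
have [le_tT|lt_Tt] := leP t T.
  have {}le_tT : t < T by rewrite lt_neqAle tT.
  apply: derivable_within_near (dd _); last by rewrite !ltW.
    near=> s; rewrite /= in_itv/=; apply/andP; split; near: s.
      exact: lt_le_nbhsr.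
    exact: lt_le_nbhsl.
  near=> s; rewrite /extend_vel.
  have -> : s < 0 = false by apply/negbTE; rewrite -leNgt; near: s; exact: lt_le_nbhsr.
  by have -> : s <= T by near: s; exact: lt_le_nbhsl.
have [l H] := brake_vel_affine (d T) (t - T).
have r0 : 0 < `|t - T - `|d T| |.
  by rewrite normr_gt0; apply: contra tdT => /eqP ?; apply/eqP; lra.
apply: (@near_affine_derivable_within _ _ _ l); near=> s.
have s0 : T < s by near: s; exact: lt_nbhsr.
rewrite /extend_vel !ltNge ?(ltW (lt_trans T0 _))//= !leNgt s0 lt_Tt/= (H (s - T)); first by ring.
have -> : s - T - (t - T) = s - t by ring.
by rewrite distrC; near: s; exact: (nbhsx_ballx t _ r0).
Unshelve. all: by end_near. Qed.

Lemma extend_le1 (R : realType) (T : R) (f d : R -> R) (t : R) : 0 < T ->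
  (forall t, 0 <= t <= T -> `|f t| <= 1) ->
  `|d 0| <= Num.sqrt (2 * (1 - `|f 0|)) ->
  `|d T| <= Num.sqrt (2 * (1 - `|f T|)) ->
  `|extend T f d t| <= 1.
Proof.
move=> T0 f1 d0 dT; rewrite /extend; have [t0|t0] := ltP t 0.
  apply: brake_pos_le1; rewrite ?normrN ?subr_ge0 ?(ltW t0)//.
  by apply: f1; rewrite lexx ltW.
have [tT|tT] := leP t T; first by rewrite f1// t0.
apply: brake_pos_le1; rewrite ?subr_ge0 ?(ltW tT)//.
by apply: f1; rewrite lexx ltW.
Qed.

(** * The cycle of implications *)

Theorem proposition22 (R : realType) (T : R) (f : R -> R)
    (hT : 0 < T) (hf : L2 `[0, T]%classic f) :
  let f' := derive_within `[0, T]%classic f in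
  [<-> (exists g : R -> R,
          [/\ L2 setT g,
              (forall t, t \in `[0, T] -> g t = f t)
            & compact (closure [set t | g^`()%classic t != 0])]);
       (exists g : R -> R,
          L2 setT g /\ (forall t, t \in `[0, T] -> g t = f t));
       (forall t, t \in `[0, T] -> `|f' t| <= Num.sqrt (2 * (1 - `|f t|)));
       (`|f' 0| <= Num.sqrt (2 * (1 - `|f 0|)) /\
        `|f' T| <= Num.sqrt (2 * (1 - `|f T|)))].
Proof.
have T0 := hT; move=> f'.
have f'jet : jet `[0, T]%classic f f' by exact: (L2_jet hf).
have [df _ f1 ddf] := hf.
have {}f1 t : 0 <= t <= T -> `|f t| <= 1 by move=> tT; apply: f1; rewrite /= in_itv.
tfae.
- by move=> [g [gL2 gf _]]; exists g.
- move=> [g [gL2 gf]] t tT.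
  have g_jet : jet setT g (derive_within setT g).
    by apply: jet_setT => a b; exact: (L2_jet gL2).
  (* The derivative within [[0, T]], one-sided at the ends, equals that of [g] on the line. *)
  have -> : f' t = derive_within setT g t.
    apply: derive_within_lim => [r r0|].
      have [s0 s1] : 0 <= t /\ t <= T by apply/andP; move: tT; rewrite in_itv.
      (* Being at most [T / 2], [e] keeps [t + e] or [t - e] inside [[0, T]], according to the half
         containing [t]. *)
      pose e := Num.min r T / 2.
      have e0 : 0 < e by rewrite divr_gt0// lt_min r0.
      have er : e < r.
        by rewrite /e; have : Num.min r T <= r by [rewrite ge_min lexx]; lra.
      have eT : e <= T / 2.
        by rewrite ler_pM2r// ge_min lexx orbT.
      have [tT2|tT2] := leP t (T / 2).
        exists (t + e); first by rewrite /= in_itv/=; apply/andP; split; lra.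
        by rewrite addrAC subrr add0r gtr0_norm// e0.
      exists (t - e); first by rewrite /= in_itv/=; apply/andP; split; lra.
      by rewrite addrAC subrr add0r normrN gtr0_norm// e0.
    have /cvg_diff_quotP gt := @jet_cvg _ _ _ _ t g_jet Logic.I.
    apply/cvg_diff_quotP => e /gt[r r0 H]; exists r => // s sT.
    by rewrite -!gf//; exact: H.
  rewrite -gf//; apply: (jet_landau t g_jet) => s.
  by have [_ _ + _] := gL2; apply.
- by move=> H; split; apply: H; rewrite in_itv/= lexx ltW.
- move=> [d0 dT]; exists (extend T f f').
  have [|||gL2 gE] := @L2_of_jet _ (extend T f f') (extend_vel T f').
  + exact: extend_jet.
  + by move=> t; exact: extend_le1.
  + have N x : lebesgue_measure.-negligible [set x : R].
      by apply/negligibleP => //; exact: lebesgue_measure_set1.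
    (* The exceptional set is the null set coming from [f] together with the four junction and rest
       points. *)
    have := negligibleU ddf (negligibleU (N 0) (negligibleU (N T)
      (negligibleU (N (- `|f' 0|)) (N (T + `|f' T|))))).
    apply: negligibleS => t; apply: contra_notP => /not_orP[/contrapT H].
    move=> /not_orP[t0 /not_orP[tT /not_orP[td0 tdT]]].
    apply: extend_vel_derivable => //.
      by rewrite !inE !negb_or; apply/and4P; split; apply/eqP.
    by move=> t0T; apply: (H _).1; rewrite /= in_itv.
  split=> //.
    move=> t; rewrite in_itv/= => /andP[t0 tT].
    by rewrite /extend ltNge t0 tT.
  set S := [set t | _].
  (* The extension is at rest outside this interval, so its derivative vanishes there. *)
  have SI : closure S `<=` `[- `|f' 0|, T + `|f' T|]%classic.
    rewrite closureE => t; apply; split; first exact: interval_closed.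
    move=> s; rewrite /S/= -derive_withinT gE /extend_vel in_itv/=.
    have := normr_ge0 (f' 0); have := normr_ge0 (f' T) => ? ?.
    case: ltP => [s0|s0].
      apply: contra_neqT; rewrite negb_and -!ltNge => /orP[?|]; last by lra.
      by rewrite brake_vel_eq0 ?oppr0// normrN; lra.
    case: leP => [sT _|sT]; first by apply/andP; split; lra.
    apply: contra_neqT; rewrite negb_and -!ltNge => /orP[|?]; first by lra.
    by rewrite brake_vel_eq0//; lra.
  apply: (subclosed_compact _ (@segment_compact _ _ _) SI).
  exact: closed_closure.
Qed.
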